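(* For any $p\in(1,\infty]$, the Banach ring $L^{\circ}(\ell_p)$ is not Hirsch.
   Context: Let $\mathbb F$ be the field of real or complex numbers. For $p\in[1,\infty]$, $\ell_p$ is the Banach space of all functions $x:\omega\to\mathbb F$ with finite norm $\|x\|_{\ell_p}$, where $\|x\|_{\ell_p}=\big(\sum_{n\in\omega}|x(n)|^p\big)^{1/p}$ if $p<\infty$ and $\|x\|_{\ell_\infty}=\sup_{n\in\omega}|x(n)|$. $L(\ell_p)$ is the Banach space of bounded linear operators on $\ell_p$ with the operator norm $\|a\|=\sup\{\|a(x)\|_{\ell_p}:x\in\ell_p,\ \|x\|_{\ell_p}\le1\}$. $L^{\circ}(\ell_p)$ is the Banach ring $L(\ell_p)$ endowed with the multiplication $\circ$ defined by $(a\circ b)(x)=a(b(x))$ for $a,b\in L(\ell_p)$, $x\in\ell_p$. A series $\sum_{n\in\omega}x_n$ in an Abelian topological group $G$ unconditionally converges to $x\in G$ if for any neighborhood $U$ of $0$ there is a finite set $F\subset\omega$ such that $\sum_{i\in J}x_i\in x+U$ for any finite set $J\subset\omega$ containing $F$; it is unconditionally convergent if it unconditionally converges to some $x\in G$. A topological ring $R$ (with product $ax$ of $a,x\in R$) is Hirsch if for any unconditionally convergent series $\sum_{n\in\omega}x_n$ in $R$ and any neighborhood $U\subseteq R$ of $0$ there exists a neighborhood $V\subseteq R$ of $0$ such that $\sum_{n\in F}a_nx_n\in U$ for any finite set $F\subset\omega$ and any sequence $(a_n)_{n\in F}\in V^F$. *)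

(* Defs.v *)
From HB Require Import structures.
From mathcomp Require Import all_boot all_order all_algebra finmap.
From mathcomp Require Import all_classical all_reals all_analysis.
From mathcomp Require Import complex.

Set Implicit Arguments.
Unset Strict Implicit.
Unset Printing Implicit Defensive.

Import Order.TTheory GRing.Theory Num.Theory.

Local Open Scope classical_set_scope.
Local Open Scope ring_scope.

HB.mixin Record isTopologicalPzRing T of TopologicalZmodule T & GRing.PzRing T
  := { mul_continuous : continuous (fun x : T * T => x.1 * x.2) }.

#[short(type="topologicalPzRingType")]
HB.structure Definition TopologicalPzRing :=
  {T of TopologicalZmodule T & GRing.PzRing T & isTopologicalPzRing T}.

Definition unconditionally_converges_to (G : topologicalZmodType)
    (x : nat -> G) (l : G) : Prop :=
  forall U : set G, nbhs (0 : G) U ->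
  exists F : {fset nat}, forall J : {fset nat}, (F `<=` J)%fset ->
    [set l + u | u in U] (\sum_(i <- J) x i).

Definition unconditionally_convergent (G : topologicalZmodType)
    (x : nat -> G) : Prop :=
  exists l : G, unconditionally_converges_to x l.

Definition hirsch (T : topologicalPzRingType) : Prop :=
  forall x : nat -> T, unconditionally_convergent x ->
  forall U : set T, nbhs (0 : T) U ->
  exists2 V : set T, nbhs (0 : T) V &
    forall (F : {fset nat}) (a : nat -> T), (forall n, n \in F -> V (a n)) ->
      U (\sum_(n <- F) a n * x n).

(* The common interface of the two scalar fields R and R[i]: a field extension
   of R together with an R-valued absolute value extending the one of R. *)
Record absolute_value (R : realType) (F : fieldType) := AbsoluteValue {
  absv :> F -> R;
  absv_ge0 : forall x, 0 <= absv x;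
  absv_eq0 : forall x, absv x = 0 -> x = 0;
  absvD : forall x y, absv (x + y) <= absv x + absv y;
  absvM : forall x y, absv (x * y) = absv x * absv y;
  absv_emb : {rmorphism R -> F};
  absv_embE : forall r, absv (absv_emb r) = `|r| }.

Definition real_abs (R : realType) : absolute_value R R :=
  @AbsoluteValue R R Num.norm (@normr_ge0 R R) (@normr0_eq0 R R)
    (@ler_normD R R) (@normrM R) idfun (fun=> erefl).

Section complex_absolute_value.
Context (R : realType).

Let normc_ge0 (z : R[i]) : 0 <= Normc.normc z.
Proof. by case: z => a b /=; rewrite sqrtr_ge0. Qed.

Let normc_real (r : R) : Normc.normc (real_complex R r) = `|r|.
Proof. by rewrite /= expr0n addr0 sqrtr_sqr. Qed.

Definition complex_abs : absolute_value R R[i] :=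
  @AbsoluteValue R R[i] (@Normc.normc R) normc_ge0 (@Normc.eq0_normc R)
    (@le_normcD R) (@Normc.normcM R) (real_complex R) normc_real.

End complex_absolute_value.

Section absolute_value_theory.
Context (R : realType) (F : fieldType) (v : absolute_value R F).

Lemma absv_nat n : v n%:R = n%:R.
Proof. by rewrite -(rmorph_nat (absv_emb v)) absv_embE normr_nat. Qed.

Lemma absv0 : v 0 = 0.
Proof. exact: (absv_nat 0). Qed.

Lemma absvN1 : v (-1) = 1.
Proof.
apply/eqP; rewrite -[_ == 1](@eqrXn2 _ 2%N) ?absv_ge0 ?ler01//.
by rewrite expr1n expr2 -absvM mulrNN mulr1 (absv_nat 1).
Qed.

End absolute_value_theory.

Section lpnorm.
Context (R : realType) (F : fieldType) (v : absolute_value R F).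
Implicit Types (p : \bar R) (x y : nat -> F^o).
Local Open Scope ereal_scope.

Definition lpnorm p x : \bar R :=
  match p with
  | r%:E => (\sum_(0 <= n <oo) (v (x n) `^ r)%:E) `^ r^-1
  | +oo => ereal_sup (range (fun n => (v (x n))%:E))
  | -oo => 0 (* irrelevant: only used for 1 <= p *)
  end.

Lemma lpnormE (r : R) x : (0 < r)%R ->
  lpnorm r%:E x = Lnorm counting r%:E (EFin \o (fun n => v (x n))).
Proof.
move=> r0; rewrite Lnorm_counting//=; congr (_ `^ _).
by apply: eq_eseriesr => n _ /=; rewrite ger0_norm ?absv_ge0.
Qed.

Lemma le_absv_lpnorm p x n : 1 <= p -> (v (x n))%:E <= lpnorm p x.
Proof.
case: p => [r|_|//]; last by apply: ereal_sup_ubound; exists n.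
rewrite lee_fin => r1 /=; have r0 : (0 < r)%R by exact: lt_le_trans r1.
have -> : (v (x n))%:E = (v (x n) `^ r)%:E `^ r^-1.
  by rewrite poweR_EFin -powRrM mulfV ?gt_eqF// powRr1 ?absv_ge0.
have pos k : 0 <= (v (x k) `^ r)%:E by rewrite lee_fin powR_ge0.
apply: gt0_ler_poweR.
- by rewrite invr_ge0 ltW.
- by rewrite in_itv /= leey andbT.
- by rewrite in_itv /= leey andbT; apply: nneseries_ge0.
- apply: (@le_trans _ _ (\sum_(0 <= k < n.+1) (v (x k) `^ r)%:E)).
    by rewrite big_nat_recr//= leeDr// sume_ge0.
  exact: nneseries_lim_ge.
Qed.

Lemma lpnorm_ge0 p x : 1 <= p -> 0 <= lpnorm p x.
Proof.
move=> p1; apply: le_trans (le_absv_lpnorm x 0 p1).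
by rewrite lee_fin absv_ge0.
Qed.

Lemma lpnormD p x y : 1 <= p ->
  lpnorm p (x + y)%R <= lpnorm p x + lpnorm p y.
Proof.
move=> p1; have vD n : (v ((x + y)%R n) <= v (x n) + v (y n))%R.
  exact: absvD.
case: p p1 => [r|_|//].
- rewrite lee_fin => r1; have r0 : (0 < r)%R by exact: lt_le_trans r1.
  rewrite [in leRHS]lpnormE// [in leRHS]lpnormE//.
  apply: le_trans (minkowski_EFin _ _ _ r1); rewrite ?Lnorm_counting//=.
  apply: gt0_ler_poweR.
  + by rewrite invr_ge0 ltW.
  + rewrite in_itv /= leey andbT; apply: nneseries_ge0 => n _ _.
    by rewrite lee_fin powR_ge0.
  + rewrite in_itv /= leey andbT; apply: nneseries_ge0 => n _ _.
    by rewrite lee_fin powR_ge0.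
  + apply: lee_nneseries => n _ //=; first by rewrite lee_fin powR_ge0.
    rewrite lee_fin ger0_norm ?addr_ge0 ?absv_ge0//.
    by apply: ge0_ler_powR; rewrite ?nnegrE ?addr_ge0 ?absv_ge0// ltW.
- apply: ub_ereal_sup => _ [n _ <-].
  apply: (@le_trans _ _ ((v (x n))%:E + (v (y n))%:E)).
    by rewrite -EFinD lee_fin.
  by apply: leeD; apply: ereal_sup_ubound; exists n.
Qed.

Lemma lpnormZ p (c : F) x : 1 <= p -> lpnorm p (c *: x) = (v c)%:E * lpnorm p x.
Proof.
have vZ n : v ((c *: x) n) = (v c * v (x n))%R by rewrite -absvM.
case: p => [r|_|//].
- rewrite lee_fin => r1 /=; have r0 : (0 < r)%R by exact: lt_le_trans r1.
  have pos k : 0 <= (v (x k) `^ r)%:E by rewrite lee_fin powR_ge0.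
  under eq_eseriesr => n _ do rewrite vZ powRM ?absv_ge0// EFinM.
  rewrite nneseriesZl//.
  rewrite poweRM ?lee_fin ?powR_ge0//; last exact: nneseries_ge0.
  by rewrite poweR_EFin -powRrM mulfV ?gt_eqF// powRr1 ?absv_ge0.
- rewrite /= -ereal_supZl ?absv_ge0//; last first.
    by apply/set0P; exists (v (x 0))%:E, 0%N.
  rewrite image_comp; congr ereal_sup; apply: eq_imagel => n _ /=.
  by rewrite vZ EFinM.
Qed.

Lemma lpnorm0 p : 1 <= p -> lpnorm p 0%R = 0.
Proof. by move=> p1; rewrite -(scale0r 0%R) lpnormZ// absv0 mul0e. Qed.

End lpnorm.

Section lp.
Context (R : realType) (F : fieldType) (v : absolute_value R F).
Context (p : \bar R) (p1 : (1 <= p)%E).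

(* The unused proof of 1 <= p is kept as an argument so that the vector space
   and norm instances on [lp] can be inferred from the type. *)
Definition lp_pred of (1 <= p)%E : {pred nat -> F^o} :=
  fun x => `[< (lpnorm v p x < +oo)%E >].

Record lp := Lp { lp_val :> nat -> F^o; _ : lp_val \in lp_pred p1 }.

HB.instance Definition _ := [isSub for lp_val].
HB.instance Definition _ := [Choice of lp by <:].

Let lp_submod_closed : submod_closed (lp_pred p1).
Proof.
split=> [|c x y]; rewrite !unfold_in; first by apply/asboolP; rewrite lpnorm0.
move=> /asboolP xoo /asboolP yoo; apply/asboolP.
apply: le_lt_trans (lpnormD _ _ _ p1) _; rewrite lpnormZ//.
by rewrite lte_add_pinfty// lte_mul_pinfty// lee_fin absv_ge0.
Qed.

HB.instance Definition _ := GRing.SubChoice_isSubLmodule.Build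
  F (nat -> F^o) (lp_pred p1) lp lp_submod_closed.

Lemma lp_lty (x : lp) : (lpnorm v p x < +oo)%E.
Proof. by have := valP x; rewrite unfold_in => /asboolP. Qed.

Definition lp_norm (x : lp) : R := fine (lpnorm v p x).

Lemma lp_normE (x : lp) : (lp_norm x)%:E = lpnorm v p x.
Proof.
by rewrite fineK// ge0_fin_numE ?lpnorm_ge0// lp_lty.
Qed.

Lemma lp_normD (x y : lp) : lp_norm (x + y) <= lp_norm x + lp_norm y.
Proof. by rewrite -lee_fin EFinD !lp_normE; exact: lpnormD. Qed.

Lemma lp_normZ (c : F) (x : lp) : lp_norm (c *: x) = v c * lp_norm x.
Proof. by apply: EFin_inj; rewrite EFinM !lp_normE; exact: lpnormZ. Qed.

Lemma lp_norm_eq0 (x : lp) : lp_norm x = 0 -> x = 0.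
Proof.
move=> x0; apply/val_inj/funext => n /=; apply: (@absv_eq0 _ _ v).
apply/eqP.
rewrite eq_le absv_ge0 andbT -lee_fin.
by apply: le_trans (le_absv_lpnorm _ _ n p1) _; rewrite -lp_normE x0.
Qed.

Let lp_normN (x : lp) : lp_norm (- x) = lp_norm x.
Proof. by rewrite -scaleN1r lp_normZ absvN1 mul1r. Qed.

Let lp_normMn (x : lp) n : lp_norm (x *+ n) = lp_norm x *+ n.
Proof. by rewrite -scaler_nat lp_normZ absv_nat mulr_natl. Qed.

Lemma lp_norm0 : lp_norm 0 = 0.
Proof. by rewrite -(scale0r 0) lp_normZ absv0 mul0r. Qed.

HB.instance Definition _ :=
  @Num.Zmodule_isNormed.Build R lp lp_norm lp_normD lp_norm_eq0
    lp_normMn lp_normN.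

End lp.

Section bounded_operators.
Context (R : realType) (F : fieldType) (v : absolute_value R F).
Context (p : \bar R) (p1 : (1 <= p)%E).
Local Notation lp := (lp v p1).
Implicit Types (x y : lp).

Let normlZ (c : F) x : `|c *: x| = v c * `|x|.
Proof. exact: lp_normZ. Qed.

Definition bounded_linear_pred : {pred lp -> lp} :=
  fun a => `[< linear a /\ exists M : R, forall x, `|a x| <= M * `|x| >].

Record bounded_op := BoundedOp {
  bop_val :> lp -> lp; _ : bop_val \in bounded_linear_pred }.

HB.instance Definition _ := [isSub for bop_val].
HB.instance Definition _ := [Choice of bounded_op by <:].

Let bounded_zmod_closed : zmod_closed bounded_linear_pred.
Proof.
split=> [|a b]; rewrite !unfold_in.
  apply/asboolP; split=> [c x y|]; first by rewrite scaler0 addr0.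
  by exists 0 => x; rewrite mul0r normr0.
move=> /asboolP[la [M aM]] /asboolP[lb [N bN]]; apply/asboolP; split.
  move=> c x y /=; rewrite !fctE la lb scalerBr opprD.
  by rewrite addrACA.
exists (M + N) => x; rewrite !fctE mulrDl (le_trans (ler_normB _ _))//.
exact: lerD.
Qed.

HB.instance Definition _ := GRing.SubChoice_isSubZmodule.Build
  (lp -> lp) bounded_linear_pred bounded_op bounded_zmod_closed.

Implicit Types a b : bounded_op.

Lemma bop_linear a : linear a.
Proof. by have := valP a; rewrite unfold_in => /asboolP[]. Qed.

Lemma bop_bounded a : exists M : R, forall x, `|a x| <= M * `|x|.
Proof. by have := valP a; rewrite unfold_in => /asboolP[]. Qed.

Lemma bopD a b x : (a + b) x = a x + b x. Proof. by []. Qed.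

Lemma bopZ a (c : F) x : a (c *: x) = c *: a x.
Proof.
have a0 : a 0 = 0.
  by have := bop_linear a (-1) 0 0; rewrite scaler0 addr0 scaleN1r addNr.
by have := bop_linear a c x 0; rewrite a0 !addr0.
Qed.

Definition op_norm a : R := sup [set `|a x| | x in [set x : lp | `|x| <= 1]].

Let op_has_sup a : has_sup [set `|a x| | x in [set x : lp | `|x| <= 1]].
Proof.
split; first by exists `|a 0|, 0 => //=; rewrite normr0.
have [M aM] := bop_bounded a; exists `|M| => _ [x /= x1 <-].
apply: le_trans (aM x) _; apply: le_trans (ler_norm _) _.
by rewrite normrM normr_id ler_piMr.
Qed.

Let op_norm_ub a x : `|x| <= 1 -> `|a x| <= op_norm a.
Proof. by move=> x1; apply: sup_upper_bound; [exact: op_has_sup|exists x]. Qed.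
Lemma op_norm_ge0 a : 0 <= op_norm a.
Proof. by apply: le_trans (op_norm_ub a (x := 0) _); rewrite ?normr0. Qed.

Lemma le_op_norm a x : `|a x| <= op_norm a * `|x|.
Proof.
have [x0|x0] := eqVneq `|x| 0.
  have [M aM] := bop_bounded a.
  by rewrite x0 mulr0 (le_trans (aM x))// x0 mulr0.
have xgt0 : 0 < `|x| by rewrite lt_neqAle eq_sym x0 normr_ge0.
pose c := absv_emb v `|x|^-1.
have vc : v c = `|x|^-1 by rewrite absv_embE ger0_norm// invr_ge0 ltW.
have := @op_norm_ub a (c *: x); rewrite bopZ !normlZ vc mulVf// => /(_ (lexx _)).
by rewrite mulrC ler_pdivrMr.
Qed.

Lemma op_norm_le a (M : R) : 0 <= M ->
  (forall x, `|a x| <= M * `|x|) -> op_norm a <= M.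
Proof.
move=> M0 aM; apply: ge_sup; first by have [] := op_has_sup a.
move=> _ [x /= x1 <-]; apply: le_trans (aM x) _.
by rewrite -[leRHS]mulr1 ler_wpM2l.
Qed.

Let op_normD a b : op_norm (a + b) <= op_norm a + op_norm b.
Proof.
apply: op_norm_le => [|x]; first by rewrite addr_ge0 ?op_norm_ge0.
rewrite mulrDl (le_trans (ler_normD _ _))//.
by apply: lerD; exact: le_op_norm.
Qed.

Let op_norm_eq0 a : op_norm a = 0 -> a = 0.
Proof.
move=> a0; apply/val_inj/funext => x /=; apply/eqP.
rewrite -[_ == _]normr_le0.
by have := le_op_norm a x; rewrite a0 mul0r.
Qed.

Let bopMn a n x : (a *+ n) x = a x *+ n.
Proof.
by elim: n => // n IH; rewrite !mulrS -IH.
Qed.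

Let op_normMn a n : op_norm (a *+ n) = op_norm a *+ n.
Proof.
case: n => [|n].
  apply/eqP; rewrite !mulr0n eq_le op_norm_ge0 andbT.
  by apply: op_norm_le => // x; rewrite mul0r normr0.
apply/eqP; rewrite eq_le; apply/andP; split.
  apply: op_norm_le => [|x]; first by rewrite mulrn_wge0 ?op_norm_ge0.
  by rewrite bopMn normrMn mulrnAl lerMn2r le_op_norm.
rewrite -mulr_natr -ler_pdivlMr ?ltr0n//.
apply: op_norm_le => [|x]; first by rewrite divr_ge0 ?op_norm_ge0.
rewrite mulrAC ler_pdivlMr ?ltr0n// mulr_natr -normrMn -bopMn.
exact: le_op_norm.
Qed.

Let op_normN a : op_norm (- a) = op_norm a.
Proof.
rewrite /op_norm; congr sup; apply: eq_imagel => x _.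
have -> : (- a) x = - a x by [].
exact: normrN.
Qed.

HB.instance Definition _ := @Num.Zmodule_isNormed.Build R bounded_op op_norm
  op_normD op_norm_eq0 op_normMn op_normN.
HB.instance Definition _ :=
  PseudoMetric.copy bounded_op (pseudoMetric_normed bounded_op).
HB.instance Definition _ := isPointed.Build bounded_op 0.
HB.instance Definition _ :=
  NormedZmod_PseudoMetric_eq.Build R bounded_op erefl.
HB.instance Definition _ :=
  PreTopologicalNmodule_isTopologicalNmodule.Build bounded_op
    (@pseudometric_normed_Zmodule.add_continuous R bounded_op).
HB.instance Definition _ :=
  TopologicalNmodule_isTopologicalZmodule.Build bounded_op
    (@oppr_continuous R bounded_op).

Let comp_bounded a b : (bop_val a \o b) \in bounded_linear_pred.
Proof.
rewrite unfold_in; apply/asboolP; split=> [c x y /=|].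
  by rewrite !bop_linear.
exists (op_norm a * op_norm b) => x /=.
apply: le_trans (le_op_norm _ _) _.
by rewrite -mulrA ler_wpM2l ?op_norm_ge0// le_op_norm.
Qed.

Let id_bounded : (idfun : lp -> lp) \in bounded_linear_pred.
Proof.
rewrite unfold_in; apply/asboolP; split=> //.
by exists 1 => x; rewrite mul1r.
Qed.

Definition bop_comp a b : bounded_op := BoundedOp (comp_bounded a b).

Definition bop_id : bounded_op := BoundedOp id_bounded.

Let bop_compA : associative bop_comp.
Proof. by move=> a b c; exact/val_inj. Qed.

Let bop_comp1l : left_id bop_id bop_comp.
Proof. by move=> a; exact/val_inj. Qed.

Let bop_comp1r : right_id bop_id bop_comp.
Proof. by move=> a; exact/val_inj. Qed.

Let bop_compDl : left_distributive bop_comp +%R.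
Proof. by move=> a b c; exact/val_inj. Qed.

Let bop_compDr : right_distributive bop_comp +%R.
Proof.
move=> a b c; apply/val_inj/funext => x /=.
have := bop_linear a 1 (b x) (c x); rewrite !scale1r => abc.
exact: abc.
Qed.

HB.instance Definition _ := GRing.Zmodule_isPzRing.Build bounded_op
  bop_compA bop_comp1l bop_comp1r bop_compDl bop_compDr.

Lemma bopM a b x : (a * b) x = a (b x). Proof. by []. Qed.

Lemma op_normE a : `|a| = sup [set `|a x| | x in [set x : lp | `|x| <= 1]].
Proof. by []. Qed.

Lemma op_normM a b : `|a * b| <= `|a| * `|b|.
Proof.
apply: op_norm_le => [|x]; first by rewrite mulr_ge0.
apply: le_trans (le_op_norm a (b x)) _.
by rewrite -mulrA ler_wpM2l ?op_norm_ge0// le_op_norm.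
Qed.

Let bop_mul_continuous :
  continuous (fun ab : bounded_op * bounded_op => ab.1 * ab.2).
Proof.
move=> [a b]; apply/cvgrPdist_lt => e e0.
have S0 : 0 < `|a| + `|b| + 1 by rewrite ltr_wpDl ?addr_ge0.
pose d := Num.min 1 (e / (`|a| + `|b| + 1)).
have d0 : 0 < d by rewrite lt_min ltr01 divr_gt0.
near=> a' b' => /=.
have aa' : `|a - a'| < d by near: a'; exact: cvgr_dist_lt.
have bb' : `|b - b'| < d by near: b'; exact: cvgr_dist_lt.
have b'1 : `|b'| <= `|b| + 1.
  rewrite -[b'](subKr b) (le_trans (ler_normB _ _))// lerD2l.
  by rewrite (le_trans (ltW bb'))// ge_min lexx.
rewrite (_ : a * b - a' * b' = a * (b - b') + (a - a') * b'); last first.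
  by rewrite mulrBr mulrBl addrA subrK.
rewrite (le_lt_trans (ler_normD _ _))//.
rewrite (le_lt_trans (lerD (op_normM _ _) (op_normM _ _)))//.
apply: (@lt_le_trans _ _ (d * (`|a| + `|b| + 1))); last first.
  by rewrite -ler_pdivlMr// ge_min lexx orbT.
rewrite -addrA mulrDr mulrC; apply: ler_ltD.
  by rewrite ler_wpM2r// ltW.
apply: (@le_lt_trans _ _ (`|a - a'| * (`|b| + 1))); first exact: ler_wpM2l.
by rewrite ltr_pM2r// ltr_wpDl.
Unshelve. all: by end_near. Qed.

HB.instance Definition _ :=
  isTopologicalPzRing.Build bounded_op bop_mul_continuous.

End bounded_operators.

(* Main.v *)
(* Let x_n map x to x(0) e_n/(n+1). The series sum_n x_n converges
   unconditionally, because (1/(n+1))_n lies in l_p (in c_0 if p = +oo) for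
   p > 1. Let a_n map x to eps x(n) e_0, an operator of norm at most eps. Then
   sum_(n < N) a_n x_n maps x to (eps sum_(n < N) 1/(n+1)) x(0) e_0, whose norm
   is unbounded in N since the harmonic series diverges. *)
Require Import Defs.
From mathcomp Require Import all_boot all_order all_algebra.
From mathcomp Require Import all_classical all_reals all_analysis.
From mathcomp Require Import complex finmap.
Import Order.TTheory.
Import GRing.Theory Num.Theory.

Set Implicit Arguments.
Unset Strict Implicit.
Unset Printing Implicit Defensive.

Local Open Scope classical_set_scope.
Local Open Scope ring_scope.

(** * Convergence and divergence of sums of powers of $1/(n+1)$ *)

Section harmonic.
Context (R : realType).
Implicit Types (r M : R).

(* Cauchy condensation: the dyadic block [2^K - 1, 2^(K+1) - 1) contributes at
   most 2^K * (2^-K)^r = (2^(1-r))^K. *)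
Lemma sum_harmonic_powR_le r K : 0 <= r ->
  \sum_(0 <= n < (2 ^ K).-1) harmonic n `^ r
    <= \sum_(0 <= k < K) (2 `^ (1 - r)) ^+ k.
Proof.
move=> r0; elim: K => [|K IH]; first by rewrite !big_geq.
have gt0 n : (0 < 2 ^ n)%N by rewrite expn_gt0.
rewrite (@big_cat_nat _ _ _ (2 ^ K).-1)//=; last first.
  by rewrite -ltnS !prednK// leq_pexp2l.
rewrite [leRHS]big_nat_recr//= lerD//.
have -> : (2 `^ (1 - r)) ^+ K = ((2 : R) ^+ K)^-1 `^ r *+ 2 ^ K.
  rewrite -powR_mulrn ?powR_ge0// -powRrM mulrC powRrM powR_mulrn ?ler0n//.
  rewrite powRD; last by rewrite expf_eq0 pnatr_eq0 andbF implybT.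
  rewrite powRr1 ?exprn_ge0//. rewrite -[RHS]mulr_natl natrX; congr *%R.
  rewrite -[in RHS]powR_inv1 ?exprn_ge0//.
  by rewrite -powRrM mulN1r.
(* Writing the multiplicity as the length of the index range turns the multiple into a constant sum,
   comparable term by term. *)
have block : (2 ^ K = (2 ^ K.+1).-1 - (2 ^ K).-1)%N.
  rewrite expnS mul2n -addnn.
  by case: (2 ^ K)%N (gt0 K) => // m _; rewrite addSn /= addKn.
rewrite [X in _ *+ X]block -sumr_const_nat; apply: ler_sum_nat => n /andP[nK _].
rewrite ge0_ler_powR ?nnegrE ?invr_ge0 ?exprn_ge0//=.
rewrite lef_pV2 ?posrE ?exprn_gt0// -natrX ler_nat.
by rewrite -ltnS prednK in nK.
Qed.

(** Since $n\le 2^n-1$, each partial sum is bounded by one over complete dyadic blocks, hence by a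
    geometric series of ratio $2^{1-r}<1$. *)
Lemma nneseries_harmonic_powR_lty r : 1 < r ->
  (\sum_(0 <= n <oo) (harmonic n `^ r)%:E < +oo)%E.
Proof.
move=> r1; have r0 : 0 <= r by rewrite ltW// (lt_trans _ r1).
set z : R := 2 `^ (1 - r).
have z0 : 0 <= z by exact: powR_ge0.
have z1 : z < 1.
  by rewrite /z /powR pnatr_eq0 expR_lt1 nmulr_rlt0 ?subr_lt0// ln_gt0// ltr1n.
apply: (@le_lt_trans _ _ ((1 - z)^-1)%:E); last exact: ltry.
apply: lime_le.
  by apply: is_cvg_nneseries => n _ _; rewrite lee_fin powR_ge0.
apply: nearW => n; rewrite sumEFin lee_fin.
apply: (@le_trans _ _ (\sum_(0 <= k < (2 ^ n).-1) harmonic k `^ r)).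
  rewrite [leRHS](@big_cat_nat _ _ _ n)//=; last first.
    by rewrite -ltnS prednK ?expn_gt0// ltn_expl.
  by rewrite lerDl sumr_ge0// => k _; exact: powR_ge0.
apply: (le_trans (sum_harmonic_powR_le n r0)); rewrite -/z.
have := congr1 (@^~ n) (@geometric_seriesE R 1 z (negbT (lt_eqF z1))).
rewrite /series /geometric /= => gE.
under eq_bigr do rewrite -[_ ^+ _]mul1r.
rewrite gE mul1r ler_pdivrMr ?subr_gt0// mulVf ?gt_eqF ?subr_gt0//.
by rewrite gerBl exprn_ge0.
Qed.

(** The partial sums are nondecreasing, so an upper bound would force the divergent series to
    converge. *)
Lemma exists_sum_harmonic_gt M : exists n, M < \sum_(0 <= i < n) harmonic i.
Proof.
apply: contrapT => /forallNP bd; apply: (@dvg_harmonic R).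
apply: nondecreasing_is_cvgn.
  by apply: nondecreasing_series => n _ _; exact: harmonic_ge0.
by exists M => _ [n _ <-]; rewrite leNgt; apply/negP/bd.
Qed.

End harmonic.

(** * Unit vectors and rank-one operators on $\ell_p$ *)

Section not_hirsch.
Context (R : realType) (F : fieldType) (v : absolute_value R F).
Context (p : \bar R) (p1 : (1 <= p)%E).
Local Notation lp := (lp v p1).
Local Notation bop := (bounded_op v p1).

Lemma absv_le_norm (x : lp) n : v (x n) <= `|x|.
Proof. by rewrite -lee_fin [(`|x|)%:E]lp_normE; exact: le_absv_lpnorm. Qed.

Lemma norm_lpZ (c : F) (x : lp) : `|c *: x| = v c * `|x|.
Proof. exact: lp_normZ. Qed.

Let unit_seq (n : nat) : nat -> F^o := fun k => (n == k)%:R.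

Let lpnorm_unit_seq n : lpnorm v p (unit_seq n) = 1%:E.
Proof.
have vu k : v (unit_seq n k) = (n == k)%:R by rewrite /unit_seq absv_nat.
case: p p1 => [r|_|//]; last first.
  apply/eqP; rewrite eq_le; apply/andP; split.
    by apply: ub_ereal_sup => _ [k _ <-]; rewrite vu lee_fin lern1 leq_b1.
  by apply: ereal_sup_ubound; exists n => //; rewrite vu eqxx.
rewrite lee_fin => r1 /=; have r0 : 0 < r by exact: lt_le_trans r1.
have pos k : (0 <= (v (unit_seq n k) `^ r)%:E)%E by rewrite lee_fin powR_ge0.
(* Only the last term of the head survives; the other terms are powers of zero, which vanish because
   [r] is nonzero. *)
rewrite (nneseries_split 0 n.+1)// eseries0 ?adde0; last first.
  by move=> k nk _; rewrite vu ltn_eqF// powR0// gt_eqF.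
rewrite big_nat_recr//= big1_seq ?add0e.
  by rewrite vu eqxx powR1 poweR_EFin powR1.
move=> k /andP[_]; rewrite mem_index_iota => /andP[_ kn].
by rewrite vu gtn_eqF// powR0// gt_eqF.
Qed.

Let unit_seq_lp n : unit_seq n \in lp_pred v p1.
Proof. by rewrite unfold_in; apply/asboolP; rewrite lpnorm_unit_seq ltry. Qed.

Definition lp_unit n : lp := Lp (unit_seq_lp n).

Lemma lp_unitE n k : lp_unit n k = (n == k)%:R. Proof. by []. Qed.

Lemma norm_lp_unit n : `|lp_unit n| = 1.
Proof. by apply: EFin_inj; rewrite [LHS]lp_normE; exact: lpnorm_unit_seq. Qed.

Let rank_one_bounded m (y : lp) :
  (fun x : lp => (x m : F) *: y) \in @bounded_linear_pred R F v p p1.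
Proof.
rewrite unfold_in; apply/asboolP; split.
  by move=> c x z; rewrite scalerA -scalerDl.
exists `|y| => x; rewrite norm_lpZ mulrC.
by rewrite ler_wpM2l// absv_le_norm.
Qed.

(** This is $e_m^*\otimes y$. Both families $x_n$ and $a_n$ have this form, which reduces operator
    computations to vectors. *)
Definition rank_one m (y : lp) : bop := BoundedOp (rank_one_bounded m y).

Lemma rank_oneE m y (x : lp) : rank_one m y x = (x m : F) *: y.
Proof. by []. Qed.

Lemma rank_one0 m : rank_one m 0 = 0.
Proof. by apply/val_inj/funext => x; rewrite /= scaler0. Qed.

Lemma rank_oneD m y z : rank_one m (y + z) = rank_one m y + rank_one m z.
Proof. by apply/val_inj/funext => x; rewrite /= scalerDr. Qed.

Lemma rank_one_sum m (I : Type) (s : seq I) (y : I -> lp) :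
  rank_one m (\sum_(i <- s) y i) = \sum_(i <- s) rank_one m (y i).
Proof. exact: (big_morph _ (rank_oneD m) (rank_one0 m)). Qed.

(** Composition evaluates $e_n^*$ at $z$; this makes every product $a_nx_n$ a multiple of
    $e_0^*\otimes e_0$. *)
Lemma rank_oneM m n y z :
  rank_one n y * rank_one m z = rank_one m ((z n : F) *: y).
Proof. by apply/val_inj/funext => x; rewrite /= scalerA. Qed.

(** Coordinate functionals have norm at most 1. *)
Lemma norm_rank_one_le m y : `|rank_one m y| <= `|y|.
Proof.
apply: op_norm_le => // x; rewrite norm_lpZ mulrC.
by rewrite ler_wpM2l// absv_le_norm.
Qed.

Lemma lpZE (c : F) (x : lp) k : (c *: x) k = c * (x k : F).
Proof. by []. Qed.

Lemma lp_sumE (I : Type) (s : seq I) (y : I -> lp) k :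
  (\sum_(i <- s) y i : lp) k = \sum_(i <- s) (y i k : F).
Proof. by elim/big_rec2: _ => // i a b _ <-. Qed.


(** * The harmonic vector for $p>1$ and the failure of the Hirsch property *)

Hypothesis p_gt1 : (1 < p)%E.

Let emb_harmonic : nat -> F^o := fun n => absv_emb v (harmonic n).

Let absv_emb_harmonic n : v (emb_harmonic n) = harmonic n.
Proof. by rewrite absv_embE ger0_norm ?harmonic_ge0. Qed.

Let emb_harmonic_lp : emb_harmonic \in lp_pred v p1.
Proof.
rewrite unfold_in; apply/asboolP; case: p p_gt1 => [r r1|_|//] /=.
  apply: poweR_lty; under eq_eseriesr do rewrite absv_emb_harmonic.
  exact: nneseries_harmonic_powR_lty.
apply: (@le_lt_trans _ _ 1%:E); last exact: ltry.
apply: ub_ereal_sup => _ [n _ <-]; rewrite absv_emb_harmonic lee_fin.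
by rewrite invf_le1 ?ler1n.
Qed.

Let lp_harmonic : lp := Lp emb_harmonic_lp.

(** Domination by the harmonic vector bounds the norm by a tail independent of [x]. This uniformity
    covers all finite index sets containing $\{0,\dots,N-1\}$ at once. *)
Lemma norm_harmonic_tail_le (e : R) : 0 < e -> exists N, forall x : lp,
  (forall n, v (x n) <= harmonic n) ->
  (forall n, (n < N)%N -> x n = 0) -> `|x| <= e.
Proof.
(* Bare sequences replace the type [lp], which depends on [p], so that [p] can be split into
   cases. *)
move=> e0; suff [N HN] : exists N, forall x : nat -> F^o,
    (forall n, v (x n) <= harmonic n) ->
    (forall n, (n < N)%N -> x n = 0) -> (lpnorm v p x <= e%:E)%E.
  by exists N => x xh x0; rewrite -lee_fin [(`|x|)%:E]lp_normE; exact: HN.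
case: p p_gt1 => [r|_|//]; last first.
  have [N _ HN] := cvgr_lt 0 (@cvg_harmonic R) e e0.
  exists N => x xh x0; apply: ub_ereal_sup => _ [n _ <-]; rewrite lee_fin.
  have [nN|Nn] := ltnP n N; first by rewrite x0// absv0 ltW.
  exact: le_trans (xh n) (ltW (HN n Nn)).
rewrite lte_fin => r1; have r0 : 0 < r by exact: lt_trans r1.
have h0 n : true -> (0 <= (harmonic n `^ r)%:E :> \bar R)%E.
  by move=> _; rewrite lee_fin powR_ge0.
(* The tail is compared with $e^r$ because the norm is the $1/r$-th power of the sum. *)
have er0 : 0 < e `^ r by exact: powR_gt0.
have er0' : (0%:E < (e `^ r)%:E)%E by rewrite lte_fin.
have [N _ HN] := nneseries_tail_cvg (nneseries_harmonic_powR_lty r1) h0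
  (open_ereal_lt' er0').
exists N => x xh x0 /=.
have x_ge0 k : (0 <= (v (x k) `^ r)%:E)%E by rewrite lee_fin powR_ge0.
have -> : (e%:E = (e `^ r)%:E `^ r^-1)%E.
  by rewrite poweR_EFin -powRrM mulfV ?gt_eqF// powRr1// ltW.
apply: gt0_ler_poweR.
- by rewrite invr_ge0 ltW.
- by rewrite in_itv /= leey andbT; exact: nneseries_ge0.
- by rewrite in_itv /= leey andbT lee_fin ltW.
rewrite (nneseries_split 0 N)// big1_seq ?add0e; last first.
  move=> k /andP[_]; rewrite mem_index_iota => /andP[_ kN].
  by rewrite x0// absv0 powR0// gt_eqF.
apply: le_trans (ltW (HN N (leqnn N))); apply: lee_nneseries => // n _.
by rewrite lee_fin ge0_ler_powR ?nnegrE ?absv_ge0 ?harmonic_ge0// ltW.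
Qed.

(** This is $x_n$: as a matrix, its only nonzero entry is $1/(n+1)$, in row $n$ of column $0$. *)
Let column n : bop := rank_one 0 ((emb_harmonic n : F) *: lp_unit n).

Let column_convergent : unconditionally_convergent column.
Proof.
exists (rank_one 0 lp_harmonic) => U /nbhs_normP[e /= e0 eU].
have [N HN] := norm_harmonic_tail_le (divr_gt0 e0 (ltr0n R 2)).
exists [fset i in iota 0 N]%fset => J NJ.
exists (\sum_(i <- J) column i - rank_one 0 lp_harmonic); last first.
  by rewrite addrC subrK.
apply: eU => /=; rewrite sub0r normrN -rank_one_sum.
set y : lp := \sum_(i <- J) _.
(* The partial sum is the harmonic vector cut down to [J], so its error is supported off [J], hence
   beyond [N]. *)
have yE k : y k = if k \in J then emb_harmonic k else 0.
  rewrite lp_sumE; case: ifPn => kJ.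
    rewrite (bigD1_seq k) ?fset_uniq// lpZE lp_unitE eqxx mulr1.
    rewrite big1 => [|i ik]; first exact: addr0.
    by rewrite lpZE lp_unitE (negbTE ik) mulr0.
  rewrite big1_seq// => i /andP[_ iJ]; rewrite lpZE lp_unitE.
  case: eqP => [ik|]; last by rewrite mulr0.
  by rewrite -ik iJ in kJ.
have -> : rank_one 0 y - rank_one 0 lp_harmonic = rank_one 0 (y - lp_harmonic).
  by apply/val_inj/funext => x; rewrite /= scalerBr.
apply: (le_lt_trans (norm_rank_one_le _ _)).
apply: (@le_lt_trans _ _ (e / 2)); last first.
  by rewrite ltr_pdivrMr// ltr_pMr// ltr1n.
have dE k : (y - lp_harmonic) k = if k \in J then 0 else - emb_harmonic k.
  have -> : (y - lp_harmonic) k = (y k : F) - emb_harmonic k by [].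
  by rewrite yE; case: ifP; rewrite ?subrr ?sub0r.
apply: HN => k; rewrite dE.
  case: ifP => _; first by rewrite absv0 harmonic_ge0.
  by rewrite -mulN1r absvM absvN1 mul1r absv_emb_harmonic.
by move=> kN; rewrite (fsubsetP NJ) // inE mem_iota.
Qed.

Lemma not_hirsch_bounded_op : ~ hirsch bop.
Proof.
move=> /(_ column column_convergent (ball 0 1) (nbhsx_ballx _ _ ltr01)).
move=> [V /nbhs_normP[d /= d0 dV] HV].
(* Halving makes the norm of each [a i] strictly less than [d]; then [n] is taken so large that
   $e\sum_{i<n}1/(i+1)$ exceeds 1, the radius of the test ball. *)
pose e := d / 2; have e0 : 0 < e by rewrite divr_gt0.
have [n hn] := exists_sum_harmonic_gt e^-1.
pose a i := rank_one i ((absv_emb v e : F) *: lp_unit 0).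
have aV i : V (a i).
  apply: dV => /=; rewrite sub0r normrN.
  apply: (le_lt_trans (norm_rank_one_le _ _)).
  rewrite norm_lpZ norm_lp_unit mulr1 absv_embE gtr0_norm//.
  by rewrite ltr_pdivrMr// ltr_pMr// ltr1n.
have {HV} := HV [fset i in iota 0 n]%fset a (fun i _ => aV i).
set S := \sum_(i <- _) _; rewrite -ball_normE /= sub0r normrN.
apply/negP; rewrite -leNgt.
have -> : S =
    rank_one 0 (absv_emb v (e * \sum_(0 <= i < n) harmonic i) *: lp_unit 0).
  rewrite mulr_sumr rmorph_sum scaler_suml rank_one_sum /S.
  rewrite (perm_big (iota 0 n)); last first.
    by apply: uniq_perm => [||k]; rewrite ?fset_uniq ?iota_uniq// inE.
  rewrite /index_iota subn0; apply: eq_bigr => i _.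
  rewrite rank_oneM scalerA mulrC lpZE lp_unitE eqxx mulr1.
  by rewrite (rmorphM _ e).
set T := rank_one 0 _.
(* Coordinate 0 of $Te_0$ bounds the norm of $T$ from below, since $e_0$ has norm 1. *)
have := le_trans (absv_le_norm (T (lp_unit 0)) 0) (le_op_norm T (lp_unit 0)).
rewrite norm_lp_unit mulr1; apply: le_trans.
rewrite rank_oneE !lpZE !lp_unitE eqxx mul1r mulr1 absv_embE ger0_norm.
  by rewrite mulrC -ler_pdivrMr// mul1r ltW.
by rewrite mulr_ge0 ?sumr_ge0 ?(ltW e0)// => i _; exact: harmonic_ge0.
Qed.

End not_hirsch.

Theorem proposition7p8 (R : realType) (p : \bar R) (hp : (1 < p)%E) :
  ~ hirsch (bounded_op (real_abs R) (ltW hp)) /\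
  ~ hirsch (bounded_op (complex_abs R) (ltW hp)).
Proof. by split; exact: not_hirsch_bounded_op. Qed.
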